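(* Let $n\ge 2$ be an integer and let $\lambda_1,\dots,\lambda_n$ be complex numbers with power sums $S_m$ and elementary symmetric polynomials $\sigma_m$. If there are $\gamma>0$, $a\ge 0$ and $v\in[0,1]$ such that $|S_m|\le\gamma m^v a^m$ for all $m=1,\dots,n$, then $$|\sigma_m|\le\gamma m^{v-1}(1+\gamma)^{m-1}a^m,\qquad m=1,\dots,n.$$ Moreover, $$\max_{k=1,\dots,n}|\lambda_k|\le\left((1+\gamma)n^{\frac{v-1}{n-1}}+\gamma\right)a\le(1+2\gamma)a.$$
   Context: For a family $\{\lambda_k\}_{k=1}^n$ of complex numbers (repetitions allowed), $S_m=\sum_{k=1}^n\lambda_k^m$ for $m=1,2,\dots$, and $\sigma_m=\sum_{1\le j_1<\dots<j_m\le n}\lambda_{j_1}\cdots\lambda_{j_m}$ for $m=1,\dots,n$. *)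

(* Defs.v *)
From mathcomp Require Import all_boot all_order all_algebra.
From mathcomp Require Import complex.
From mathcomp Require Import reals exp.
From mathcomp Require Import mpoly.

Set Implicit Arguments.
Unset Strict Implicit.
Unset Printing Implicit Defensive.

Import Order.TTheory GRing.Theory Num.Theory.
Local Open Scope ring_scope.

Definition power_sum (C : pzSemiRingType) (n : nat) (l : 'I_n -> C) (m : nat) : C :=
  \sum_(k < n) l k ^+ m.

(* mesym sums over the m-element subsets of the index set, i.e. over the index
   tuples j_1 < ... < j_m (see mesym_tupleE). *)
Definition elem_sym (C : comNzRingType) (n : nat) (l : 'I_n -> C) (m : nat) : C :=
  (mesym n C m).@[l].

(* The norm `|z| of R[i] takes its values in R[i]; this is the modulus as an
   element of R. *)
Definition cmod (R : rcfType) (z : R[i]) : R := ComplexField.Normc.normc z.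

(* The neutral element 0 is harmless: moduli are nonnegative. *)
Definition max_mod (R : rcfType) (n : nat) (l : 'I_n -> R[i]) : R :=
  \big[Num.max/0]_(k < n) cmod (l k).

(* Main.v *)
Require Import Defs.
From mathcomp Require Import all_boot all_order all_algebra.
From mathcomp Require Import complex reals exp.
From mathcomp Require Import mpoly interval_inference convex ring lra.
Import Order.TTheory GRing.Theory Num.Theory.
Local Open Scope ring_scope.

(** Write [s_m], [e_m] for the moduli of the power sums and of the elementary
    symmetric polynomials of the [lambda_k].

    Newton's identities ([newton]) give
    [m e_m <= s_m e_0 + s_(m-1) e_1 + ... + s_1 e_(m-1)].
    The bound on [e_m] follows by strong induction ([newton_bound]): since
    [0 <= v <= 1], one has [i^v j^(v-1) <= m^v] for all [1 <= i, j <= m], so the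
    right-hand side is at most [gamma m^v a^m] times
    [1 + gamma ((1+gamma)^(m-2) + ... + (1+gamma) + 1)], and this factor sums
    to [(1+gamma)^(m-1)].

    For the bound on the [lambda_k], put [q = n^((v-1)/(n-1))].  Concavity of
    the logarithm ([ln_chord]) gives [m^(v-1) <= q^(m-1)] for [1 <= m <= n],
    hence [e_m <= gamma c^(m-1) a^m] with [c = (1+gamma) q].  Each [lambda_k] is
    a root of a monic polynomial with coefficients [+- sigma_m], so
    [x = |lambda_k|] satisfies
    [x^n <= gamma a (x^(n-1) + (c a) x^(n-2) + ... + (c a)^(n-1))].  If
    [x > (c + gamma) a], then [gamma a < x - c a], and the right-hand side is
    less than [x^n - (c a)^n], which is absurd ([cauchy_root_bound]).  Finally
    [q <= 1].

    Both Newton's identities and the root equation come from the sums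
    [elem_sym_omit l k m] over the [m]-element index sets that avoid [k].
    Writing [t_m] for them, [sigma_(m+1) = t_(m+1) + lambda_k t_m], which
    expresses [t_m] through the [sigma_i] and the powers of [- lambda_k].
    Summing [lambda_k t_m] over [k] counts each [(m+1)]-element set [m+1] times,
    which is Newton's identity, and [t_n = 0] is the root equation. *)

Set Implicit Arguments.
Unset Strict Implicit.

(** * Newton's identities and the root equation *)

Lemma elem_symE (C : comNzRingType) (n : nat) (l : 'I_n -> C) (m : nat) :
  elem_sym l m = \sum_(h : {set 'I_n} | #|h| == m) \prod_(i in h) l i.
Proof.
rewrite /elem_sym /mesym raddf_sum; apply: eq_bigr => h _ /=.
rewrite rmorph_prod; apply: eq_bigr => i _ /=; exact: mevalXU.
Qed.

Lemma elem_sym0 (C : comNzRingType) (n : nat) (l : 'I_n -> C) :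
  elem_sym l 0 = 1.
Proof. by rewrite /elem_sym mesym0E rmorph1. Qed.

(** The [m]-th elementary symmetric polynomial in the [l i] with [i != k]. *)
Definition elem_sym_omit (C : comNzRingType) (n : nat) (l : 'I_n -> C)
    (k : 'I_n) (m : nat) : C :=
  \sum_(h : {set 'I_n} | (#|h| == m) && (k \notin h)) \prod_(i in h) l i.

(** Removing [k] from the index sets that contain it. *)
Lemma sum_containing (C : comNzRingType) (n : nat) (l : 'I_n -> C)
    (k : 'I_n) (m : nat) :
  \sum_(h : {set 'I_n} | (#|h| == m.+1) && (k \in h)) \prod_(i in h) l i =
  l k * elem_sym_omit l k m.
Proof.
rewrite /elem_sym_omit big_distrr /=.
rewrite (reindex_onto (fun h => k |: h) (fun h => h :\ k)) /=; last first.
  by move=> h /andP[_ kh]; rewrite setD1K.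
apply: eq_big => [h|h /andP[_ /eqP hk]].
  rewrite setU11 andbT cardsU1.
  have [kh|kh] := boolP (k \in h); rewrite /= ?andbF.
    apply/negP => /andP[_ /eqP hk].
    by move: kh; rewrite -hk !inE eqxx.
  by rewrite setU1K // eqxx !andbT.
have kh : k \notin h by rewrite -hk !inE eqxx.
by rewrite big_setU1.
Qed.

Lemma elem_sym_split (C : comNzRingType) (n : nat) (l : 'I_n -> C)
    (k : 'I_n) (m : nat) :
  elem_sym l m.+1 = elem_sym_omit l k m.+1 + l k * elem_sym_omit l k m.
Proof.
rewrite elem_symE (bigID (fun h : {set 'I_n} => k \notin h)) /=.
rewrite -sum_containing; congr (_ + _).
by apply: eq_bigl => h; rewrite negbK.
Qed.

(** The recursion [elem_sym_split], solved for the omitted sums. *)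
Lemma elem_sym_omitE (C : comNzRingType) (n : nat) (l : 'I_n -> C)
    (k : 'I_n) (m : nat) :
  elem_sym_omit l k m = \sum_(i < m.+1) (- l k) ^+ i * elem_sym l (m - i).
Proof.
elim: m => [|m IH].
  rewrite big_ord1 expr0 mul1r elem_sym0 /elem_sym_omit (big_pred1 set0).
    by rewrite big_set0.
  move=> h; rewrite cards_eq0 /=.
  by case: eqP => [->|//]; rewrite inE.
rewrite big_ord_recl expr0 mul1r subn0 (elem_sym_split l k).
have -> : \sum_(i < m.+1) (- l k) ^+ lift ord0 i * elem_sym l (m.+1 - lift ord0 i)
    = - l k * elem_sym_omit l k m.
  rewrite IH big_distrr; apply: eq_bigr => i _.
  by rewrite lift0 /= exprS mulrA subSS.
by rewrite mulNr addrK.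
Qed.

(** Every [m]-element set [h] is counted once for each [k] in [h]. *)
Lemma sum_elem_sym_omit (C : comNzRingType) (n : nat) (l : 'I_n -> C)
    (m : nat) :
  \sum_(k < n) l k * elem_sym_omit l k m = elem_sym l m.+1 *+ m.+1.
Proof.
under eq_bigr => k _ do rewrite -sum_containing.
rewrite (exchange_big_dep (fun h : {set 'I_n} => #|h| == m.+1)) /=; last first.
  by move=> k h _ /andP[].
rewrite elem_symE -sumrMnl; apply: eq_bigr => h hm.
under eq_bigl => k do rewrite hm /=.
by rewrite sumr_const (eqP hm).
Qed.

(** Newton's identities, valid for every [m]: beyond [n] the elementary
    symmetric polynomials vanish. *)
Lemma newton (C : comNzRingType) (n : nat) (l : 'I_n -> C) (m : nat) :
  elem_sym l m.+1 *+ m.+1 =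
  \sum_(i < m.+1) (-1) ^+ i * power_sum l i.+1 * elem_sym l (m - i).
Proof.
rewrite -sum_elem_sym_omit.
under eq_bigr => k _ do rewrite elem_sym_omitE big_distrr.
rewrite exchange_big; apply: eq_bigr => i _ /=.
rewrite /power_sum -mulrA !big_distrl big_distrr; apply: eq_bigr => k _ /=.
by rewrite (exprNn (l k)) exprS; ring.
Qed.

(** Up to the sign [(-1)^n], this says that [l k] is a root of the monic
    polynomial with roots [l].  It holds because no [n]-element subset of an
    [n]-element type omits [k]. *)
Lemma elem_sym_root (C : comNzRingType) (n : nat) (l : 'I_n -> C)
    (k : 'I_n) :
  \sum_(i < n.+1) (- l k) ^+ i * elem_sym l (n - i) = 0.
Proof.
rewrite -elem_sym_omitE /elem_sym_omit big_pred0 // => h.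
apply/negP => /andP[/eqP hn].
have /eqP -> : h == setT by rewrite eqEcard subsetT cardsT card_ord hn leqnn.
by rewrite inE.
Qed.

(** * Moduli *)

Lemma cmodE (R : realType) (z : R[i]) : ((cmod z)%:C)%C = `|z|.
Proof. by []. Qed.

Lemma cmod_ge0 (R : realType) (z : R[i]) : 0 <= cmod z.
Proof. by rewrite -lecR cmodE normr_ge0. Qed.

Lemma cmodM (R : realType) (z w : R[i]) : cmod (z * w) = cmod z * cmod w.
Proof. exact: ComplexField.Normc.normcM. Qed.

Lemma cmodN (R : realType) (z : R[i]) : cmod (- z) = cmod z.
Proof. by apply: complexI; rewrite !cmodE normrN. Qed.

Lemma cmod1 (R : realType) : cmod (1 : R[i]) = 1.
Proof. exact: ComplexField.Normc.normc1. Qed.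

Lemma cmodX (R : realType) (z : R[i]) (i : nat) : cmod (z ^+ i) = cmod z ^+ i.
Proof. by elim: i => [|i IH]; rewrite ?cmod1 // !exprS cmodM IH. Qed.

Lemma cmodMn (R : realType) (z : R[i]) (m : nat) : cmod (z *+ m) = m%:R * cmod z.
Proof.
apply: complexI.
by rewrite cmodE normrMn rmorphM /= cmodE rmorph_nat mulr_natl.
Qed.

Lemma cmod_sum (R : realType) (m : nat) (F : 'I_m -> R[i]) :
  cmod (\sum_(i < m) F i) <= \sum_(i < m) cmod (F i).
Proof.
rewrite -lecR cmodE rmorph_sum; apply: le_trans (ler_norm_sum _ _ _) _.
by apply: ler_sum.
Qed.

Lemma newton_le (R : realType) (n : nat) (l : 'I_n -> R[i]) (m : nat) :
  m.+1%:R * cmod (elem_sym l m.+1) <=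
  \sum_(i < m.+1) cmod (power_sum l i.+1) * cmod (elem_sym l (m - i)).
Proof.
rewrite -cmodMn newton; apply: le_trans (cmod_sum _) _.
apply: ler_sum => i _.
by rewrite !cmodM cmodX cmodN cmod1 expr1n mul1r.
Qed.

Lemma root_le (R : realType) (n : nat) (l : 'I_n -> R[i]) (k : 'I_n) :
  cmod (l k) ^+ n <=
  \sum_(i < n) cmod (elem_sym l i.+1) * cmod (l k) ^+ (n - i.+1).
Proof.
have := elem_sym_root l k.
rewrite big_ord_recr /= subnn elem_sym0 mulr1 => /eqP.
rewrite addrC addr_eq0 => /eqP e.
rewrite -cmodX -[cmod _](_ : cmod ((- l k) ^+ n) = _); last first.
  by rewrite !cmodX cmodN.
rewrite e cmodN; apply: le_trans (cmod_sum _) _.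
rewrite (reindex_inj rev_ord_inj) /=; apply: ler_sum => i _.
by rewrite cmodM !cmodX cmodN subKn // mulrC.
Qed.

(** * Estimates for real sequences *)

(** A sequence [e] governed by a Newton-type inequality inherits the growth of
    [s]. *)
Lemma newton_bound (R : realType) (n : nat) (s e : nat -> R) (gamma a v : R)
    (hgamma : 0 < gamma) (ha : 0 <= a) (hv : 0 <= v <= 1)
    (hs0 : forall m, 0 <= s m) (he0 : forall m, 0 <= e m)
    (hs : forall m : nat, (1 <= m <= n)%N -> s m <= gamma * m%:R `^ v * a ^+ m)
    (e0 : e 0 = 1)
    (he : forall m, m.+1%:R * e m.+1 <= \sum_(i < m.+1) s i.+1 * e (m - i)%N) :
  forall m, (m < n)%N ->
    e m.+1 <= gamma * m.+1%:R `^ (v - 1) * (1 + gamma) ^+ m * a ^+ m.+1.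
Proof.
case/andP: hv => v0 v1.
elim/ltn_ind => m IH mn.
have m0 : 0 < m.+1%:R :> R by rewrite ltr0n.
rewrite -(ler_pM2l m0); apply: (le_trans (he m)).
have -> : m.+1%:R * (gamma * m.+1%:R `^ (v - 1) * (1 + gamma) ^+ m * a ^+ m.+1)
    = gamma * m.+1%:R `^ v * a ^+ m.+1 * (1 + gamma) ^+ m.
  rewrite powRB; last by rewrite pnatr_eq0 implybT.
  by rewrite powRr1 ?ler0n //; field; rewrite addrC natr1 gt_eqF.
set A := gamma * _ `^ v * _.
rewrite big_ord_recr /= subnn e0 mulr1.
have geom : 1 + gamma * (\sum_(i < m) (1 + gamma) ^+ (m - i.+1)) = (1 + gamma) ^+ m.
  have := subrXX (1 + gamma) 1 m; rewrite expr1n addrAC subrr add0r.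
  move/(canRL (subrK 1)) => ->; rewrite addrC; congr (_ * _ + _).
  by apply: eq_bigr => i _; rewrite expr1n mulr1 subnS predn_sub.
rewrite -geom mulrDr mulr1 addrC lerD //; first exact: hs.
rewrite !big_distrr /=; apply: ler_sum => i _.
have im := ltn_ord i.
(* the index m - i is positive, so the induction hypothesis applies *)
have mi : (m - i = (m - i.+1).+1)%N by rewrite subnSK.
have IHi : e (m - i)%N <= gamma * (1 + gamma) ^+ (m - i.+1) * a ^+ (m - i).
  rewrite mi; apply: le_trans (IH _ _ _) _.
  - by rewrite -mi leq_subr.
  - by apply: leq_trans mn; rewrite ltnS leq_subr.
  have g0 : 0 <= (1 + gamma) ^+ (m - i.+1).
    by apply: exprn_ge0; lra.
  rewrite ler_wpM2r ?exprn_ge0 // ler_wpM2r // ger_pMr //.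
  rewrite -[leRHS](@powRr0 R (m - i.+1).+1%:R) ler_powR ?ler1n //; lra.
have Si : s i.+1 <= gamma * m.+1%:R `^ v * a ^+ i.+1.
  apply: le_trans (hs _ _) _; first by rewrite /= (leq_trans im) // ltnW.
  rewrite ler_wpM2r ?exprn_ge0 // (ler_wpM2l (ltW hgamma)) //.
  by rewrite ge0_ler_powR ?nnegrE ?ler0n // ler_nat ltnS ltnW.
apply: le_trans (ler_pM (hs0 _) (he0 _) Si IHi) _.
rewrite /A le_eqVlt; apply/orP; left; apply/eqP.
have -> : a ^+ m.+1 = a ^+ i.+1 * a ^+ (m - i).
  by rewrite -exprD addSn subnKC // ltnW.
ring.
Qed.

(** A bound for the nonnegative solutions [x] of a polynomial inequality whose
    coefficients [e m] are dominated by a geometric sequence. *)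
Lemma cauchy_root_bound (R : realType) (n : nat) (e : nat -> R)
    (gamma c a x : R) (hgamma : 0 < gamma) (hc : 0 <= c) (ha : 0 <= a)
    (he : forall m, (m < n)%N -> e m.+1 <= gamma * c ^+ m * a ^+ m.+1)
    (hx : 0 <= x) (n0 : (0 < n)%N)
    (hr : x ^+ n <= \sum_(i < n) e i.+1 * x ^+ (n - i.+1)) :
  x <= (c + gamma) * a.
Proof.
rewrite leNgt; apply/negP => lt.
have ca : 0 <= c * a by exact: mulr_ge0.
have ga : 0 <= gamma * a by rewrite mulr_ge0 // ltW.
have x0 : 0 < x by rewrite mulrDl in lt; lra.
pose T := \sum_(i < n) x ^+ (n - i.+1) * (c * a) ^+ i.
have T0 : 0 < T.
  rewrite /T; case: n n0 {he hr T} => // n _.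
  rewrite big_ord_recl expr0 mulr1 ltr_wpDr ?exprn_gt0 //.
  by apply: sumr_ge0 => i _; rewrite mulr_ge0 ?exprn_ge0.
have h1 : x ^+ n <= gamma * a * T.
  apply: (le_trans hr); rewrite /T big_distrr; apply: ler_sum => i _ /=.
  have -> : gamma * a * (x ^+ (n - i.+1) * (c * a) ^+ i)
      = gamma * c ^+ i * a ^+ i.+1 * x ^+ (n - i.+1).
    by rewrite exprMn exprS; ring.
  by rewrite ler_wpM2r ?exprn_ge0 // he.
have h2 : x ^+ n - (c * a) ^+ n = (x - c * a) * T.
  rewrite subrXX; congr (_ * _).
  by apply: eq_bigr => i _; rewrite subnS predn_sub.
have h3 : gamma * a * T < (x - c * a) * T.
  by rewrite ltr_pM2r //; rewrite mulrDl in lt; lra.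
have h4 : 0 <= (c * a) ^+ n by exact: exprn_ge0.
by lra.
Qed.

(** Concavity of the logarithm: its chord over [1, n.+1] lies below it. *)
Lemma ln_chord (R : realType) (n m : nat) (hn : (0 < n)%N) (hm : (m <= n)%N) :
  m%:R / n%:R * ln n.+1%:R <= ln m.+1%:R :> R.
Proof.
have n0 : 0 < n%:R :> R by rewrite ltr0n.
have t0 : 0 <= m%:R / n%:R :> R by rewrite divr_ge0.
have t1 : m%:R / n%:R <= 1 :> R by rewrite ler_pdivrMr // mul1r ler_nat.
have := @concave_ln R (Itv01 t0 t1) n.+1%:R 1.
rewrite ltr0n ltr01 !convRE /= ln1 mulr0 addr0 mulr1 => /(_ isT isT).
rewrite -[unstable.onem _]/(1 - _); move/le_trans; apply.
rewrite le_eqVlt; apply/orP; left; apply/eqP; congr ln.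
by rewrite -!natr1; field; rewrite gt_eqF.
Qed.

(** The previous lemma exponentiated; the exponent [v - 1] is nonpositive, which
    reverses the inequality. *)
Lemma powR_chord (R : realType) (n m : nat) (v : R) (hv : v <= 1)
    (hn : (0 < n)%N) (hm : (m <= n)%N) :
  m.+1%:R `^ (v - 1) <= (n.+1%:R `^ ((v - 1) / n%:R)) ^+ m.
Proof.
rewrite -powR_mulrn ?powR_ge0 // -powRrM /powR !pnatr_eq0 /= ler_expR.
rewrite (_ : _ / _ * _ = (v - 1) * (m%:R / n%:R)); last by ring.
by rewrite -mulrA ler_wnM2l ?subr_le0 // ln_chord.
Qed.

Unset Implicit Arguments.
Set Strict Implicit.

Theorem theorem2 (R : realType) (n : nat) (hn : (2 <= n)%N)
    (lambda : 'I_n -> R[i]) (gamma a v : R)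
    (hgamma : 0 < gamma) (ha : 0 <= a) (hv : 0 <= v <= 1)
    (hS : forall m : nat, (1 <= m <= n)%N ->
       cmod (power_sum lambda m) <= gamma * m%:R `^ v * a ^+ m) :
  (forall m : nat, (1 <= m <= n)%N ->
     cmod (elem_sym lambda m)
       <= gamma * m%:R `^ (v - 1) * (1 + gamma) ^+ (m - 1) * a ^+ m) /\
  (max_mod lambda
     <= ((1 + gamma) * n%:R `^ ((v - 1) / (n%:R - 1)) + gamma) * a /\
   ((1 + gamma) * n%:R `^ ((v - 1) / (n%:R - 1)) + gamma) * a
     <= (1 + 2 * gamma) * a).
Proof.
have hsigma := @newton_bound R n (fun m => cmod (power_sum lambda m))
  (fun m => cmod (elem_sym lambda m)) gamma a v hgamma ha hv
  (fun m => cmod_ge0 _) (fun m => cmod_ge0 _) hS.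
rewrite elem_sym0 cmod1 in hsigma.
have {}hsigma := hsigma erefl (newton_le lambda).
case/andP: hv => v0 v1.
have n1 : 0 < n%:R - 1 :> R by rewrite subr_gt0 ltr1n.
set q := n%:R `^ _.
have q0 : 0 <= q by exact: powR_ge0.
have q1 : q <= 1.
  rewrite -[leRHS](@powRr0 R n%:R) ler_powR ?ler1n ?(ltnW hn) //.
  by rewrite ler_pdivrMr // mul0r subr_le0.
have g0 : 0 <= 1 + gamma by lra.
split; first by case=> // m /= mn; rewrite subn1 hsigma.
split; last first.
  by rewrite ler_wpM2r //; have := ler_wpM2l g0 q1; lra.
(* the maximum is seeded with 0, so its upper bounds must be nonnegative *)
have bound0 : 0 <= ((1 + gamma) * q + gamma) * a.
  by rewrite mulr_ge0 // addr_ge0 ?mulr_ge0 // (ltW hgamma).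
apply/bigmax_leP; split=> // k _.
apply: (@cauchy_root_bound R n (fun m => cmod (elem_sym lambda m))) => //.
- exact: mulr_ge0.
- move=> m mn; apply: le_trans (hsigma m mn) _.
  rewrite ler_wpM2r ?exprn_ge0 // -mulrA (ler_wpM2l (ltW hgamma)) //.
  rewrite exprMn mulrC ler_wpM2l ?exprn_ge0 //.
  (* powR_chord is stated with both indices shifted by one *)
  have := @powR_chord R n.-1 m v v1; rewrite prednK ?(ltnW hn) //.
  rewrite /q -subn1 natrB ?(ltnW hn) //; apply.
    by rewrite subn_gt0.
  by rewrite subn1 -ltnS prednK // ltnW.
- exact: cmod_ge0.
- exact: ltnW.
exact: root_le.
Qed.
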